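(* In the terminal log-wealth problem with liquidity shocks given in the context, replace the switching rates $\lambda_{01},\lambda_{10}$ by $\lambda_{01}/\varepsilon,\lambda_{10}/\varepsilon$ and the jump size $L$ by $\varepsilon\bar L$ ($\bar L$ fixed). Let $\bar\lambda=\frac{\lambda_{10}}{\lambda_{01}+\lambda_{10}}$, $\theta=\frac{\mu-r}\sigma$, $\tilde\theta=\frac{\mu-r-\lambda_{01}\bar L}\sigma$. Then, as $\varepsilon\to0$, $$\pi^*_{DKS}\to\frac{\mu-r-\lambda_{01}\bar L}{\sigma^2},\qquad f^0(t)\to(T-t)r+\bar\lambda(T-t)\frac{(\mu-r-\lambda_{01}\bar L)^2}{2\sigma^2}.$$ Therefore the homogenized efficiency loss, i.e. the limit of $\mathbf\Theta(t)$ defined by $\log x+f^0(t)=\log\bigl((1-\mathbf\Theta(t))x\bigr)+\bigl(r+\frac{\theta^2}2\bigr)(T-t)$, is $$\mathbf\Theta^{(DKS)}_{hom}(t)=1-\exp\Bigl((T-t)\,\tfrac12\{\bar\lambda\tilde\theta^2-\theta^2\}\Bigr).$$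
   Context: Parameters: $T>0$, $\lambda_{01},\lambda_{10}>0$, $r,\mu\in\mathbb R$, $\sigma>0$, $L\in[0,1)$. In the model of Diesinger, Kraft and Seifried, an agent maximizes expected logarithm of terminal wealth at time $T$ (no consumption) in a market that switches between a liquid Black–Scholes regime (drift $\mu$, volatility $\sigma$, interest rate $r$) and an illiquid regime (no trading, stock growth rate $r$), with rates $\lambda_{01}$ (liquid to illiquid) and $\lambda_{10}$ (back), each shock costing a fraction $L$ of the stock value (also if the market is illiquid at time $T$). The known solution is: the liquid-regime value function is $\log x+f^0(t)$, where the optimal liquid-regime stock fraction $\pi:=\pi^*_{DKS}$ is defined through $$0=(\mu-r)-\sigma^2\pi-\lambda_{01}\frac L{1-L\pi}$$ (the root with $L\pi<1$), and, writing $A=r+(\mu-r)\pi-\frac12\sigma^2\pi^2+\frac{\lambda_{01}}{\lambda_{10}}\bigl(r+\lambda_{10}\log(1-\pi L)\bigr)$, $$f^0(t)=\frac{\lambda_{01}}{\lambda_{01}+\lambda_{10}}\Bigl[A\,\frac{1-e^{-(\lambda_{01}+\lambda_{10})(T-t)}}{\lambda_{01}+\lambda_{10}}-\frac r{\lambda_{10}}\bigl(e^{-\lambda_{10}(T-t)}-e^{-(\lambda_{01}+\lambda_{10})(T-t)}\bigr)\Bigr]+\frac{\lambda_{10}}{\lambda_{01}+\lambda_{10}}\Bigl[\frac{\lambda_{01}r}{\lambda_{10}^2}\bigl(-1+e^{-\lambda_{10}(T-t)}\bigr)+A\,(T-t)\Bigr].$$ The Merton value (no shocks) is $\log x+\bigl(r+\frac{\theta^2}2\bigr)(T-t)$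 with $\theta=(\mu-r)/\sigma$. *)

(* Defs.v *)
From Stdlib Require Import Reals Lra Psatz ClassicalEpsilon.
From Coquelicot Require Import Coquelicot.
Open Scope R_scope.

Definition is_pi_DKS (l01 r mu sigma L p : R) : Prop :=
  L * p < 1 /\ 0 = (mu - r) - sigma ^ 2 * p - l01 * (L / (1 - L * p)).

(* The root singled out by [is_pi_DKS]; it exists and is unique by
   [pi_DKS_exists] and [pi_DKS_unique] below. *)
Definition pi_DKS (l01 r mu sigma L : R) : R :=
  epsilon (inhabits 0) (is_pi_DKS l01 r mu sigma L).

Definition A_DKS (l01 l10 r mu sigma L : R) : R :=
  let p := pi_DKS l01 r mu sigma L in
  r + (mu - r) * p - 1 / 2 * sigma ^ 2 * p ^ 2
  + l01 / l10 * (r + l10 * ln (1 - p * L)).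

Definition f0 (l01 l10 r mu sigma L T t : R) : R :=
  let A := A_DKS l01 l10 r mu sigma L in
  l01 / (l01 + l10) *
    (A * ((1 - exp (- (l01 + l10) * (T - t))) / (l01 + l10))
     - r / l10 * (exp (- l10 * (T - t)) - exp (- (l01 + l10) * (T - t))))
  + l10 / (l01 + l10) *
    (l01 * r / l10 ^ 2 * (- 1 + exp (- l10 * (T - t))) + A * (T - t)).

Definition value_DKS (l01 l10 r mu sigma L T t x : R) : R :=
  ln x + f0 l01 l10 r mu sigma L T t.

Definition theta (r mu sigma : R) : R := (mu - r) / sigma.

Definition value_Merton (r mu sigma T t x : R) : R :=
  ln x + (r + theta r mu sigma ^ 2 / 2) * (T - t).

(* [Th < 1] keeps the wealth [(1 - Th) * x] positive: [ln] is a total function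
   with a junk value off the positive reals. *)
Definition is_efficiency_loss (l01 l10 r mu sigma L T t x Th : R) : Prop :=
  Th < 1 /\
  value_DKS l01 l10 r mu sigma L T t x
  = value_Merton r mu sigma T t ((1 - Th) * x).

(* Exists and is unique for [0 < x], by [efficiency_loss_exists] and
   [efficiency_loss_unique] below. *)
Definition efficiency_loss (l01 l10 r mu sigma L T t x : R) : R :=
  epsilon (inhabits 0) (is_efficiency_loss l01 l10 r mu sigma L T t x).

Definition lambda_bar (l01 l10 : R) : R := l10 / (l01 + l10).

Definition theta_tilde (l01 r mu sigma Lbar : R) : R :=
  (mu - r - l01 * Lbar) / sigma.

Lemma pi_DKS_exists (l01 r mu sigma L : R) :
  0 < l01 -> 0 < sigma -> 0 <= L ->
  exists p, is_pi_DKS l01 r mu sigma L p.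
Proof.
intros Hl Hs [HL | <-].
2:{ exists ((mu - r) / sigma ^ 2). split.
    - lra.
    - field. lra. }
set (a := mu - r).
assert (Hs2 : 0 < sigma ^ 2) by (apply pow_lt; lra).
set (s := sigma ^ 2) in *.
set (D := (s - a * L) ^ 2 + 4 * s * l01 * L ^ 2).
assert (Hpos : 0 < 4 * s * l01 * L ^ 2).
{ repeat apply Rmult_lt_0_compat; lra. }
assert (HD : 0 <= D) by (unfold D; pose proof (pow2_ge_0 (s - a * L)); lra).
pose proof (sqrt_pos D) as Hq0.
pose proof (sqrt_sqrt D HD) as Hq.
set (q := sqrt D) in *.
assert (Hlt : 0 < q + (s - a * L)).
{ destruct (Rlt_or_le 0 (q + (s - a * L))) as [h | h]; [exact h | exfalso].
  assert (q * q <= (s - a * L) ^ 2) by nra.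
  unfold D in Hq. lra. }
exists ((s + a * L - q) / (2 * s * L)).
assert (E : 1 - L * ((s + a * L - q) / (2 * s * L))
            = (q + (s - a * L)) / (2 * s)) by (field; lra).
split.
- apply Rlt_0_minus. rewrite E. apply Rdiv_lt_0_compat; lra.
- rewrite E. fold a s.
  assert (Hqq : q ^ 2 = (s - a * L) ^ 2 + 4 * s * l01 * L ^ 2)
    by (unfold D in Hq; lra).
  replace (a - s * ((s + a * L - q) / (2 * s * L))
           - l01 * (L / ((q + (s - a * L)) / (2 * s))))
    with ((q ^ 2 - ((s - a * L) ^ 2 + 4 * s * l01 * L ^ 2))
          / (2 * L * (q + (s - a * L)))) by (field; lra).
  rewrite Hqq. field. lra.
Qed.

Lemma pi_DKS_unique (l01 r mu sigma L p q : R) :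
  0 < l01 -> 0 < sigma -> 0 <= L ->
  is_pi_DKS l01 r mu sigma L p -> is_pi_DKS l01 r mu sigma L q -> p = q.
Proof.
intros Hl Hs HL [Hp Ep] [Hq Eq].
assert (Hs2 : 0 < sigma ^ 2) by (apply pow_lt; lra).
assert (E : (p - q) * (sigma ^ 2 + l01 * L ^ 2 / ((1 - L * p) * (1 - L * q)))
            = 0).
{ replace ((p - q) * (sigma ^ 2 + l01 * L ^ 2 / ((1 - L * p) * (1 - L * q))))
    with ((mu - r - sigma ^ 2 * q - l01 * (L / (1 - L * q)))
          - (mu - r - sigma ^ 2 * p - l01 * (L / (1 - L * p))))
    by (field; lra).
  lra. }
assert (0 <= l01 * L ^ 2 / ((1 - L * p) * (1 - L * q))).
{ apply Rdiv_le_0_compat.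
  - apply Rmult_le_pos; [lra | apply pow2_ge_0].
  - apply Rmult_lt_0_compat; lra. }
apply Rmult_integral in E as [E | E]; lra.
Qed.

Lemma efficiency_loss_exists (l01 l10 r mu sigma L T t x : R) :
  0 < x -> exists Th, is_efficiency_loss l01 l10 r mu sigma L T t x Th.
Proof.
intros Hx.
set (d := f0 l01 l10 r mu sigma L T t
          - (r + theta r mu sigma ^ 2 / 2) * (T - t)).
exists (1 - exp d). unfold is_efficiency_loss, value_DKS, value_Merton.
pose proof (exp_pos d).
replace (1 - (1 - exp d)) with (exp d) by ring.
rewrite ln_mult, ln_exp by assumption.
unfold d in *; lra.
Qed.

Lemma efficiency_loss_unique (l01 l10 r mu sigma L T t x Th Th' : R) :
  0 < x ->
  is_efficiency_loss l01 l10 r mu sigma L T t x Th ->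
  is_efficiency_loss l01 l10 r mu sigma L T t x Th' -> Th = Th'.
Proof.
intros Hx [H1 E1] [H2 E2]. unfold value_Merton in *.
rewrite ln_mult in E1, E2 by lra.
assert (1 - Th = 1 - Th') by (apply ln_inv; lra).
lra.
Qed.

(* Main.v *)
(** After rescaling, the first order condition reads
    [sigma^2 pi = mu - r - l01 Lbar / (1 - eps Lbar pi)]. Positivity of the
    last fraction bounds [pi] above, hence [eps Lbar pi] is eventually at most
    [1/2], which bounds [pi] below; so [eps Lbar pi] tends to [0] and the limit
    of [pi] can be read off. In [f0] every exponential is multiplied by
    [O(eps)], and [(l01 / eps) ln (1 - eps Lbar pi)] tends to [- l01 Lbar]
    times the limit of [pi], so only [lambda_bar A (T - t)] survives. *)

Require Import Defs.
From Stdlib Require Import Reals Lra Psatz ClassicalEpsilon.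
From Coquelicot Require Import Coquelicot.
Open Scope R_scope.

(** * Algebra of real-valued limits along a filter *)

Section RealLimits.

Context {U : Type} {F : (U -> Prop) -> Prop} {FF : Filter F}.

Lemma filterlim_Rplus (f g : U -> R) (a b : R) :
  filterlim f F (locally a) -> filterlim g F (locally b) ->
  filterlim (fun x => f x + g x) F (locally (a + b)).
Proof.
intros Hf Hg.
exact (filterlim_comp_2 _ _ _ Hf Hg
         (filterlim_plus (V := R_NormedModule) a b)).
Qed.

Lemma filterlim_Rmult (f g : U -> R) (a b : R) :
  filterlim f F (locally a) -> filterlim g F (locally b) ->
  filterlim (fun x => f x * g x) F (locally (a * b)).
Proof.
intros Hf Hg.
exact (filterlim_comp_2 _ _ _ Hf Hg (filterlim_mult (K := R_AbsRing) a b)).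
Qed.

Lemma filterlim_Rminus (f g : U -> R) (a b : R) :
  filterlim f F (locally a) -> filterlim g F (locally b) ->
  filterlim (fun x => f x - g x) F (locally (a - b)).
Proof.
intros Hf Hg. apply filterlim_Rplus; [exact Hf |].
exact (filterlim_comp _ _ _ _ _ _ _ _ Hg
         (filterlim_opp (V := R_NormedModule) b)).
Qed.

Lemma filterlim_Rinv_neq0 (f : U -> R) (a : R) :
  a <> 0 -> filterlim f F (locally a) ->
  filterlim (fun x => / f x) F (locally (/ a)).
Proof.
intros Ha Hf. apply (filterlim_comp _ _ _ _ _ _ _ _ Hf).
apply (filterlim_Rbar_inv (Finite a)). congruence.
Qed.

(** Used with [f] the identity, where the product rule does not serve: the limit of [g] is either
    not yet known (the root) or depends on whether [t = T] (the exponentials). *)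
Lemma filterlim_mult_bounded_0 (f g : U -> R) (B : R) :
  filterlim f F (locally 0) -> F (fun x => Rabs (g x) <= B) ->
  filterlim (fun x => f x * g x) F (locally 0).
Proof.
intros Hf Hg.
(* No sign of [B] is assumed and [B = 0] is allowed; [Rabs B + 1] is a bound by which one can
   divide. *)
assert (HB : 0 < Rabs B + 1) by (pose proof (Rabs_pos B); lra).
apply filterlim_locally. intros e.
assert (He : 0 < e / (Rabs B + 1)).
{ apply Rdiv_lt_0_compat; [apply cond_pos | exact HB]. }
generalize (filter_and _ _
  (proj1 (filterlim_locally f 0) Hf (mkposreal _ He)) Hg).
apply filter_imp. intros x [H1 H2].
change (Rabs (f x * g x - 0) < e).
change (Rabs (f x - 0) < e / (Rabs B + 1)) in H1.
rewrite Rminus_0_r in H1 |- *. rewrite Rabs_mult.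
apply Rlt_div_r in H1; [| exact HB].
apply Rle_lt_trans with (2 := H1).
apply Rmult_le_compat_l; [apply Rabs_pos |].
pose proof (Rle_abs B). lra.
Qed.

End RealLimits.

Lemma filterlim_at_right_id (a : R) :
  filterlim (fun x => x) (at_right a) (locally a).
Proof.
exact (filterlim_filter_le_1 _ (filter_le_within _) (filterlim_id _ _)).
Qed.

Lemma at_right_pos : at_right 0 (fun eps => 0 < eps).
Proof. unfold at_right, within. now apply filter_forall. Qed.

(** * Logarithm bounds and defining equations of the chosen values *)

Lemma ln_le_minus_1 (z : R) : 0 < z -> ln z <= z - 1.
Proof.
intros Hz. pose proof (exp_ineq1_le (ln z)) as H.
rewrite exp_ln in H by exact Hz. lra.
Qed.

(** The previous bound at [/ z]. Both bounds agree with [ln] to first order at [z = 1], which makes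
    the later squeeze tight. *)
Lemma ln_ge_1_minus_inv (z : R) : 0 < z -> 1 - / z <= ln z.
Proof.
intros Hz. pose proof (ln_le_minus_1 (/ z) (Rinv_0_lt_compat _ Hz)) as H.
rewrite ln_Rinv in H by exact Hz. lra.
Qed.

Lemma pi_DKS_spec (l01 r mu sigma L : R) :
  0 < l01 -> 0 < sigma -> 0 <= L ->
  is_pi_DKS l01 r mu sigma L (pi_DKS l01 r mu sigma L).
Proof.
intros Hl Hs HL.
exact (epsilon_spec _ _ (pi_DKS_exists l01 r mu sigma L Hl Hs HL)).
Qed.

Lemma efficiency_loss_eq (l01 l10 r mu sigma L T t x : R) :
  0 < x ->
  efficiency_loss l01 l10 r mu sigma L T t x
  = 1 - exp (f0 l01 l10 r mu sigma L T t
             - (r + theta r mu sigma ^ 2 / 2) * (T - t)).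
Proof.
intros Hx.
destruct (epsilon_spec (inhabits 0) _
  (efficiency_loss_exists l01 l10 r mu sigma L T t x Hx)) as [H1 E].
fold (efficiency_loss l01 l10 r mu sigma L T t x) in H1, E.
unfold value_DKS, value_Merton in E.
rewrite ln_mult in E by lra.
replace (f0 l01 l10 r mu sigma L T t
         - (r + theta r mu sigma ^ 2 / 2) * (T - t))
  with (ln (1 - efficiency_loss l01 l10 r mu sigma L T t x)) by lra.
rewrite exp_ln; lra.
Qed.

(** * Limits under the rescaling of rates and jump size *)

Section Homogenization.

Variables (l01 l10 r mu sigma Lbar : R).
Hypotheses (Hl01 : 0 < l01) (Hl10 : 0 < l10) (Hsigma : 0 < sigma)
  (HLbar : 0 <= Lbar).

Let p (eps : R) : R := pi_DKS (l01 / eps) r mu sigma (eps * Lbar).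
Let p0 : R := (mu - r - l01 * Lbar) / sigma ^ 2.

Let Hsigma2 : 0 < sigma ^ 2.
Proof. now apply pow_lt. Qed.

(** The factor [eps] of the jump size cancels the one dividing the rate, so [eps] enters only
    through the relative jump [eps * (Lbar * p eps)]. *)
Lemma pi_DKS_rescaled (eps : R) :
  0 < eps ->
  eps * (Lbar * p eps) < 1 /\
  p eps = (mu - r - l01 * Lbar * / (1 - eps * (Lbar * p eps))) * / sigma ^ 2.
Proof.
intros Heps.
destruct (pi_DKS_spec (l01 / eps) r mu sigma (eps * Lbar)) as [H1 E].
- now apply Rdiv_lt_0_compat.
- exact Hsigma.
- apply Rmult_le_pos; lra.
- fold (p eps) in H1, E. rewrite Rmult_assoc in H1.
  split; [exact H1 |].
  replace (l01 / eps * (eps * Lbar / (1 - eps * Lbar * p eps)))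
    with (l01 * Lbar * / (1 - eps * (Lbar * p eps))) in E by (field; lra).
  replace (mu - r - l01 * Lbar * / (1 - eps * (Lbar * p eps)))
    with (sigma ^ 2 * p eps) by lra.
  field. lra.
Qed.

(** Only the product with [Lbar] enters the relative jump, and [Lbar >= 0] preserves the
    inequalities for the root. *)
Lemma pi_DKS_bounded :
  exists B, at_right 0 (fun eps => Rabs (Lbar * p eps) <= B).
Proof.
assert (Hinv : 0 < / sigma ^ 2) by now apply Rinv_0_lt_compat.
assert (HlL : 0 <= l01 * Lbar) by (apply Rmult_le_pos; lra).
(* [M] comes from dropping the nonnegative jump term, [m] from replacing [/ (1 - y)] by its bound
   2. *)
set (M := Rabs (Lbar * ((mu - r) * / sigma ^ 2))).
set (m := Rabs (Lbar * ((mu - r - 2 * (l01 * Lbar)) * / sigma ^ 2))).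
assert (HM : 0 <= M) by apply Rabs_pos.
assert (Hm : 0 <= m) by apply Rabs_pos.
exists (M + m).
(* Below this threshold [eps * M < 1 / 2], hence [y <= 1 / 2]; the summand 1 covers [M = 0]. *)
assert (Hd : 0 < / (2 * (M + 1))) by (apply Rinv_0_lt_compat; lra).
generalize (filter_and _ _ at_right_pos
  (proj1 (filterlim_locally _ _) (filterlim_at_right_id 0)
     (mkposreal _ Hd))).
apply filter_imp. intros eps [Heps Hball].
change (Rabs (eps - 0) < / (2 * (M + 1))) in Hball.
rewrite Rminus_0_r, Rabs_pos_eq in Hball by lra.
destruct (pi_DKS_rescaled eps Heps) as [H1 E].
set (y := eps * (Lbar * p eps)) in *.
assert (Hiy : 0 < / (1 - y)) by (apply Rinv_0_lt_compat; lra).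
assert (Hup : Lbar * p eps <= M).
{ apply Rle_trans with (2 := Rle_abs _).
  apply Rmult_le_compat_l; [exact HLbar |]. rewrite E.
  apply Rmult_le_compat_r; [lra |].
  pose proof (Rmult_le_pos _ _ HlL (Rlt_le _ _ Hiy)). lra. }
assert (HeM : eps * (2 * (M + 1)) < 1).
{ apply Rmult_lt_reg_r with (/ (2 * (M + 1))); [exact Hd |].
  rewrite Rmult_assoc, Rinv_r by lra. lra. }
assert (Hy : y <= 1 / 2) by (unfold y; nra).
assert (Hiy2 : / (1 - y) <= 2).
{ replace 2 with (/ (1 / 2)) by field. apply Rinv_le_contravar; lra. }
assert (Hlo : - m <= Lbar * p eps).
{ apply Rle_trans
    with (Lbar * ((mu - r - 2 * (l01 * Lbar)) * / sigma ^ 2)).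
  - unfold m.
    pose proof (Rle_abs
      (- (Lbar * ((mu - r - 2 * (l01 * Lbar)) * / sigma ^ 2)))) as H.
    rewrite Rabs_Ropp in H. lra.
  - apply Rmult_le_compat_l; [exact HLbar |]. rewrite E.
    apply Rmult_le_compat_r; [lra |].
    pose proof (Rmult_le_compat_l _ _ _ HlL Hiy2). lra. }
apply Rabs_le. lra.
Qed.

Lemma filterlim_relative_jump :
  filterlim (fun eps => eps * (Lbar * p eps)) (at_right 0) (locally 0).
Proof.
destruct pi_DKS_bounded as [B HB].
exact (filterlim_mult_bounded_0 _ _ B (filterlim_at_right_id 0) HB).
Qed.

Lemma filterlim_inv_one_minus_jump :
  filterlim (fun eps => / (1 - eps * (Lbar * p eps)))
    (at_right 0) (locally 1).
Proof.
replace (locally 1) with (locally (/ (1 - 0))) by (f_equal; field).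
apply filterlim_Rinv_neq0; [lra |].
apply filterlim_Rminus;
  [apply filterlim_const | exact filterlim_relative_jump].
Qed.

(** There is no circularity: the right-hand side of the first order condition depends on the root
    only through the relative jump, whose limit needed just a bound. *)
Lemma filterlim_pi_DKS : filterlim p (at_right 0) (locally p0).
Proof.
apply filterlim_ext_loc with
  (fun eps =>
     (mu - r - l01 * Lbar * / (1 - eps * (Lbar * p eps))) * / sigma ^ 2).
{ generalize at_right_pos. apply filter_imp. intros eps Heps.
  symmetry. now apply pi_DKS_rescaled. }
replace p0 with ((mu - r - l01 * Lbar * 1) * / sigma ^ 2)
  by (unfold p0; field; lra).
apply filterlim_Rmult; [| apply filterlim_const].
apply filterlim_Rminus; [apply filterlim_const |].
apply filterlim_Rmult;
  [apply filterlim_const | exact filterlim_inv_one_minus_jump].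
Qed.

(** With [y = eps * (Lbar * p eps)], the logarithm bounds give [- y / (1 - y) <= ln (1 - y) <= - y];
    after division by [eps] both sides have the same limit. *)
Lemma filterlim_log_jump :
  filterlim (fun eps => ln (1 - p eps * (eps * Lbar)) / eps)
    (at_right 0) (locally (- (Lbar * p0))).
Proof.
assert (HLp : filterlim (fun eps => 0 - Lbar * p eps)
                (at_right 0) (locally (- (Lbar * p0)))).
{ replace (- (Lbar * p0)) with (0 - Lbar * p0) by ring.
  apply filterlim_Rminus; [apply filterlim_const |].
  apply filterlim_Rmult; [apply filterlim_const | exact filterlim_pi_DKS]. }
apply (filterlim_le_le
  (fun eps => (0 - Lbar * p eps) * / (1 - eps * (Lbar * p eps))) _
  (fun eps => 0 - Lbar * p eps) (Finite (- (Lbar * p0)))).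
- generalize at_right_pos. apply filter_imp. intros eps Heps.
  destruct (pi_DKS_rescaled eps Heps) as [H1 _].
  replace (p eps * (eps * Lbar)) with (eps * (Lbar * p eps)) by ring.
  assert (Hz : 0 < 1 - eps * (Lbar * p eps)) by lra.
  pose proof (ln_le_minus_1 _ Hz).
  pose proof (ln_ge_1_minus_inv _ Hz) as Hge.
  split.
  + apply -> Rle_div_r; [| exact Heps].
    apply Rle_trans with (2 := Hge). right. field. lra.
  + apply Rle_div_l; [exact Heps |]. lra.
- simpl. replace (- (Lbar * p0)) with (- (Lbar * p0) * 1) by ring.
  apply filterlim_Rmult; [exact HLp | exact filterlim_inv_one_minus_jump].
- exact HLp.
Qed.

(** The interest terms add up to [r * (1 + l01 / l10)]. Since
    [sigma ^ 2 * p0 = mu - r - l01 * Lbar], the remaining terms add up to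
    [sigma ^ 2 * p0 ^ 2 / 2]. *)
Lemma filterlim_A_DKS :
  filterlim
    (fun eps => A_DKS (l01 / eps) (l10 / eps) r mu sigma (eps * Lbar))
    (at_right 0)
    (locally (r / lambda_bar l01 l10
              + (mu - r - l01 * Lbar) ^ 2 / (2 * sigma ^ 2))).
Proof.
apply filterlim_ext_loc with
  (fun eps => r + (mu - r) * p eps - 1 / 2 * sigma ^ 2 * (p eps * p eps)
    + (l01 / l10 * r + l01 * (ln (1 - p eps * (eps * Lbar)) / eps))).
{ generalize at_right_pos. apply filter_imp. intros eps Heps.
  unfold A_DKS. fold (p eps). cbv zeta. field. lra. }
replace (r / lambda_bar l01 l10
         + (mu - r - l01 * Lbar) ^ 2 / (2 * sigma ^ 2))
  with (r + (mu - r) * p0 - 1 / 2 * sigma ^ 2 * (p0 * p0)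
        + (l01 / l10 * r + l01 * - (Lbar * p0)))
  by (unfold lambda_bar, p0; field; lra).
pose proof filterlim_pi_DKS as Hp.
repeat first
  [ apply filterlim_const | exact Hp | exact filterlim_log_jump
  | apply filterlim_Rminus | apply filterlim_Rplus | apply filterlim_Rmult ].
Qed.

Lemma exp_neg_bounds (z : R) : 0 <= z -> 0 < exp (- z) <= 1.
Proof.
intros Hz. split; [apply exp_pos |].
rewrite <- exp_0. destruct (Rle_lt_or_eq_dec _ _ Hz) as [H | <-].
- left. apply exp_increasing. lra.
- rewrite Ropp_0. lra.
Qed.

Lemma filterlim_f0 (T t : R) :
  t <= T ->
  filterlim
    (fun eps => f0 (l01 / eps) (l10 / eps) r mu sigma (eps * Lbar) T t)
    (at_right 0)
    (locally ((T - t) * r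
              + lambda_bar l01 l10 * (T - t)
                * ((mu - r - l01 * Lbar) ^ 2 / (2 * sigma ^ 2)))).
Proof.
intros HtT.
set (e1 := fun eps => exp (- (l10 / eps) * (T - t))).
set (e2 := fun eps => exp (- (l01 / eps + l10 / eps) * (T - t))).
assert (Hb : forall l eps, 0 < l -> 0 < eps ->
  0 < exp (- (l / eps) * (T - t)) <= 1).
{ intros l eps Hl Heps.
  replace (- (l / eps) * (T - t)) with (- (l / eps * (T - t))) by ring.
  apply exp_neg_bounds. apply Rmult_le_pos; [| lra].
  left. now apply Rdiv_lt_0_compat. }
assert (He1 : forall eps, 0 < eps -> 0 < e1 eps <= 1).
{ intros. now apply Hb. }
assert (He2 : forall eps, 0 < eps -> 0 < e2 eps <= 1).
{ intros eps Heps. unfold e2.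
  replace (l01 / eps + l10 / eps) with ((l01 + l10) / eps) by (field; lra).
  apply Hb; lra. }
(* Boundedness replaces decay of the exponentials, so [t = T], where they are constantly 1, needs no
   separate case. *)
assert (Hvanish : forall k : R -> R,
  (forall eps, 0 < eps -> Rabs (k eps) <= 1) ->
  filterlim (fun eps => eps * k eps) (at_right 0) (locally 0)).
{ intros k Hk. apply filterlim_mult_bounded_0 with 1.
  - apply filterlim_at_right_id.
  - generalize at_right_pos. now apply filter_imp. }
(* The weights are ratios of rates and do not change; each coefficient of an exponential has one
   more rate below than above and so yields one factor [eps]. *)
apply filterlim_ext_loc with
  (fun eps =>
     let A := A_DKS (l01 / eps) (l10 / eps) r mu sigma (eps * Lbar) in
     l01 / (l01 + l10) *
       (A * (/ (l01 + l10) * (eps * (1 - e2 eps)))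
        - r / l10 * (eps * (e1 eps - e2 eps)))
     + l10 / (l01 + l10) *
       (l01 * r / l10 ^ 2 * (eps * (- 1 + e1 eps)) + A * (T - t))).
{ generalize at_right_pos. apply filter_imp. intros eps Heps.
  unfold f0. cbv zeta. fold (e1 eps) (e2 eps).
  field. repeat split; lra. }
cbv zeta.
set (A0 := r / lambda_bar l01 l10
           + (mu - r - l01 * Lbar) ^ 2 / (2 * sigma ^ 2)).
replace ((T - t) * r + lambda_bar l01 l10 * (T - t)
         * ((mu - r - l01 * Lbar) ^ 2 / (2 * sigma ^ 2)))
  with (l01 / (l01 + l10) * (A0 * (/ (l01 + l10) * 0) - r / l10 * 0)
        + l10 / (l01 + l10) * (l01 * r / l10 ^ 2 * 0 + A0 * (T - t)))
  by (unfold A0, lambda_bar; field; lra).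
pose proof filterlim_A_DKS as HA.
(* [Hvanish] has to precede the product rule, which would split [eps] from its bounded factor. *)
repeat first
  [ apply filterlim_const | exact HA
  | apply Hvanish; intros eps Heps; apply Rabs_le;
    specialize (He1 eps Heps); specialize (He2 eps Heps); lra
  | apply filterlim_Rminus | apply filterlim_Rplus | apply filterlim_Rmult ].
Qed.

End Homogenization.

Theorem lemma5 (T l01 l10 r mu sigma Lbar t x : R) :
  0 < T -> 0 < l01 -> 0 < l10 -> 0 < sigma -> 0 <= Lbar ->
  0 <= t <= T -> 0 < x ->
  filterlim (fun eps => pi_DKS (l01 / eps) r mu sigma (eps * Lbar))
    (at_right 0) (locally ((mu - r - l01 * Lbar) / sigma ^ 2)) /\
  filterlim
    (fun eps => f0 (l01 / eps) (l10 / eps) r mu sigma (eps * Lbar) T t)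
    (at_right 0)
    (locally ((T - t) * r
              + lambda_bar l01 l10 * (T - t)
                * ((mu - r - l01 * Lbar) ^ 2 / (2 * sigma ^ 2)))) /\
  filterlim
    (fun eps =>
       efficiency_loss (l01 / eps) (l10 / eps) r mu sigma (eps * Lbar) T t x)
    (at_right 0)
    (locally (1 - exp ((T - t) * (1 / 2 *
       (lambda_bar l01 l10 * theta_tilde l01 r mu sigma Lbar ^ 2
        - theta r mu sigma ^ 2))))).
Proof.
intros HT Hl01 Hl10 Hsigma HLbar [_ HtT] Hx.
pose proof (filterlim_f0 l01 l10 r mu sigma Lbar Hl01 Hl10 Hsigma HLbar
              T t HtT) as Hf0.
split; [now apply filterlim_pi_DKS | split; [exact Hf0 |]].
apply filterlim_ext with
  (fun eps => 1 - exp (f0 (l01 / eps) (l10 / eps) r mu sigma (eps * Lbar) T t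
                       - (r + theta r mu sigma ^ 2 / 2) * (T - t))).
{ intros eps. symmetry. now apply efficiency_loss_eq. }
apply filterlim_Rminus; [apply filterlim_const |].
eapply filterlim_comp; [| apply continuous_exp].
(* The interest part [(T - t) * r] cancels against the Merton value, leaving the difference of the
   squared risk premia. *)
replace ((T - t) * (1 / 2 *
   (lambda_bar l01 l10 * theta_tilde l01 r mu sigma Lbar ^ 2
    - theta r mu sigma ^ 2)))
  with ((T - t) * r + lambda_bar l01 l10 * (T - t)
        * ((mu - r - l01 * Lbar) ^ 2 / (2 * sigma ^ 2))
        - (r + theta r mu sigma ^ 2 / 2) * (T - t))
  by (unfold theta, theta_tilde, lambda_bar; field; lra).
apply filterlim_Rminus; [exact Hf0 | apply filterlim_const].
Qed.
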